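(* Let $a:\mathbb N\to\mathbb C$ be a sequence of weights whose Dirichlet series $A(s)=\sum_{n\ge1}a(n)n^{-s}$ converges absolutely on $\Re s>\sigma_0$, and let $\mathcal T_a(z)=\sum_{i\ge1}\frac{a(i)}{i^2}F(z,i)$ be its Fejér–Dirichlet lift. Then: (1) For every integer $n\ge1$, $\mathcal T_a(n)=\sum_{d\mid n}a(d)=(a*1)(n)$. (2) For all $s$ with $\Re s>\max\{1,\sigma_0\}$, $$\sum_{n=1}^{\infty}\frac{\mathcal T_a(n)}{n^s}=\zeta(s)A(s);$$ extension of this identity to other $s$ follows by analytic continuation, when available.
   Context: $\mathbb N=\{1,2,3,\dots\}$. For $z\in\mathbb C$ and an integer $i\ge2$, $F(z,i)=i+2\sum_{k=1}^{i-1}(i-k)\cos(2\pi kz/i)$, and $F(z,1):=1$. Equivalently $F(z,i)=\left(\frac{\sin(\pi z)}{\sin(\pi z/i)}\right)^2$ with removable singularities filled in. At an integer $z=n$ only finitely many terms of the series defining $\mathcal T_a(n)$ are nonzero. $\zeta$ is the Riemann zeta function and $*$ denotes Dirichlet convolution, $(f*g)(n)=\sum_{d\mid n}f(d)g(n/d)$, with $1(n)\equiv1$. *)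

(* Defs.v *)
From Stdlib Require Import Reals List Arith.
From Coquelicot Require Import Coquelicot.
Import ListNotations.
Open Scope R_scope.

Definition Cexp (z : C) : C :=
  (exp (Re z) * cos (Im z), exp (Re z) * sin (Im z)).

Definition Ccos (z : C) : C :=
  ((Cexp (Ci * z) + Cexp (- (Ci * z))) / RtoC 2)%C.

(* [nat_cpow n s] is n^s, used for n >= 1 only. *)
Definition nat_cpow (n : nat) (s : C) : C := Cexp (s * RtoC (ln (INR n)))%C.

(* Arithmetic functions on {1, 2, 3, ...} are functions on [nat] whose value at
   0 is never used: series sum the terms of index [S k].

   [CSeries u] is the sum u 1 + u 2 + ...; as with Coquelicot's [Series], its
   value is meaningful only if the series converges. *)
Definition Cis_series (u : nat -> C) (l : C) : Prop :=
  is_series (K := C_AbsRing) (V := C_NormedModule) (fun k => u (S k)) l.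

Definition CSeries (u : nat -> C) : C :=
  (Series (fun k => Re (u (S k))), Series (fun k => Im (u (S k)))).

Definition Csum_list (u : nat -> C) (l : list nat) : C :=
  fold_right (fun d acc => (u d + acc)%C) (RtoC 0) l.

Definition divisors (n : nat) : list nat :=
  filter (fun d => Nat.eqb (n mod d) 0) (seq 1 n).

Definition dirichlet_conv (f g : nat -> C) (n : nat) : C :=
  Csum_list (fun d => (f d * g (n / d)%nat)%C) (divisors n).

Definition one_fun (n : nat) : C := RtoC 1.

(* For i = 1 the sum is empty and the value is 1. *)
Definition F (z : C) (i : nat) : C :=
  (RtoC (INR i) +
   RtoC 2 * Csum_list (fun k =>
     RtoC (INR (i - k)) * Ccos (RtoC (2 * PI * INR k) * z / RtoC (INR i)))
     (seq 1 (i - 1)))%C.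

Definition lift_term (a : nat -> C) (z : C) (i : nat) : C :=
  (a i / RtoC (INR i ^ 2) * F z i)%C.

Definition lift (a : nat -> C) (z : C) : C := CSeries (lift_term a z).

Definition dirichlet_term (f : nat -> C) (s : C) (n : nat) : C :=
  (f n / nat_cpow n s)%C.

Definition dirichlet_series (f : nat -> C) (s : C) : C :=
  CSeries (dirichlet_term f s).

Definition dirichlet_abs_conv (f : nat -> C) (s : C) : Prop :=
  ex_series (fun k => Cmod (dirichlet_term f s (S k))).

(* The Riemann zeta function on the half-plane Re s > 1. *)
Definition zeta (s : C) : C := dirichlet_series one_fun s.

Definition half_plane (sigma : R) (s : C) : Prop := sigma < Re s.

Definition analytic_at (f : C -> C) (s0 : C) : Prop :=
  exists (c : nat -> C) (r : R), 0 < r /\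
    forall s : C, Cmod (s - s0)%C < r ->
      is_pseries (K := C_AbsRing) (V := C_NormedModule) c (s - s0)%C (f s).

Definition Copen (U : C -> Prop) : Prop := open (T := C_UniformSpace) U.

Definition Cconnected (U : C -> Prop) : Prop :=
  forall V W : C -> Prop, Copen V -> Copen W ->
    (forall s, U s -> V s \/ W s) ->
    (exists s, U s /\ V s) -> (exists s, U s /\ W s) ->
    exists s, U s /\ V s /\ W s.

(* [g] is an analytic continuation to the domain [U] of the function [f]
   given on [H]. *)
Definition analytic_continuation
    (f : C -> C) (H : C -> Prop) (g : C -> C) (U : C -> Prop) : Prop :=
  Copen U /\ Cconnected U /\ (exists s, U s /\ H s) /\
  (forall s, U s -> analytic_at g s) /\
  (forall s, U s -> H s -> g s = f s).

(* Main.v *)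
Require Import Defs.
From Stdlib Require Import Reals List ZArith Arith Lia Lra Classical.
From Coquelicot Require Import Coquelicot.
Open Scope R_scope.

(** At an integer [n] the Fejér factor is a divisibility test.  The Fejér sum at
    angle [t] satisfies [fejer t m * (1 - cos t) = 1 - cos (m t)]; at
    [t = 2 pi n / i] and [m = i] the right-hand side vanishes, so the sum is 0
    unless [cos t = 1], that is unless [i] divides [n], and then it is [i^2]
    ([fejer_at_integer]).  Hence the series of the lift at [n] is the finite sum
    of [a d] over the divisors of [n] ([lift_series_at_integer]).

    The Dirichlet series of these divisor sums is a Dirichlet product of
    [a d / d^s] and [1 / k^s].  Its partial sum up to [N] is
    [sum_(d <= N) x_d Y(N / d)] with [Y] the partial sums of the second factor
    ([hyperbola_sum]).  Replacing [Y(N / d)] by its limit costs a sum of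
    [|x_d|] weighted by tails of the second series, which tends to 0: for [d]
    small against [N] the tails are small, and for the other [d] the weights
    are ([weighted_tails_vanish]).  This gives [dirichlet_product], a Mertens
    theorem for Dirichlet series; that of zeta converges by comparison with a
    telescoping sum ([zeta_abs_conv]).

    For continuations, the product of two analytic functions is analytic by the
    Cauchy product of their power series.  Uniqueness is the identity theorem:
    a zero of an analytic function is either isolated or interior to the zero
    set ([isolated_zeros]), which splits the domain into two disjoint open sets,
    so that connectedness makes one of them empty
    ([analytic_zero_on_connected]). *)

Notation is_Cseries := (is_series (K := C_AbsRing) (V := C_NormedModule)).
Notation is_Cpseries := (is_pseries (K := C_AbsRing) (V := C_NormedModule)).

(** * Series of complex numbers *)

(** The topology of [C] used by [is_series] is that of the product of two real
    lines.  This trades it for the modulus, so that real limit theorems apply. *)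
Lemma is_Cseries_Cmod (u : nat -> C) (l : C) :
  is_Cseries u l <-> is_lim_seq (fun n => Cmod (sum_n u n - l)) 0.
Proof.
split.
- intros H. apply is_lim_seq_spec. intros eps.
  assert (HL : locally_norm (K := C_AbsRing) (V := C_NormedModule) l
                 (fun z => Cmod (z - l) < eps)).
  { exists eps. intros z Hz. exact Hz. }
  apply (locally_le_locally_norm (K := C_AbsRing) (V := C_NormedModule) l _) in HL.
  destruct (H _ HL) as [N HN]. exists N. intros n Hn.
  rewrite Rminus_0_r, Rabs_pos_eq by apply Cmod_ge_0.
  exact (HN n Hn).
- intros H P HP.
  apply (locally_norm_le_locally (K := C_AbsRing) (V := C_NormedModule) l _) in HP.
  destruct HP as [eps HP].
  apply is_lim_seq_spec in H. destruct (H eps) as [N HN].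
  exists N. intros n Hn. apply HP. specialize (HN n Hn).
  rewrite Rminus_0_r, Rabs_pos_eq in HN by apply Cmod_ge_0. exact HN.
Qed.

Lemma Re_sum_n_m (u : nat -> C) (n m : nat) :
  Re (sum_n_m u n m) = sum_n_m (fun k => Re (u k)) n m.
Proof.
destruct (le_lt_dec n (S m)) as [H|H].
2: now rewrite !sum_n_m_zero by lia.
induction m as [|m IH].
- destruct n as [|n]; [now rewrite !sum_n_n|now rewrite !sum_n_m_zero by lia].
- destruct (le_lt_dec n (S m)) as [H'|H'].
  + rewrite !sum_n_Sm by lia. rewrite <- IH by lia. reflexivity.
  + now rewrite !sum_n_m_zero by lia.
Qed.

Lemma Im_sum_n_m (u : nat -> C) (n m : nat) :
  Im (sum_n_m u n m) = sum_n_m (fun k => Im (u k)) n m.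
Proof.
destruct (le_lt_dec n (S m)) as [H|H].
2: now rewrite !sum_n_m_zero by lia.
induction m as [|m IH].
- destruct n as [|n]; [now rewrite !sum_n_n|now rewrite !sum_n_m_zero by lia].
- destruct (le_lt_dec n (S m)) as [H'|H'].
  + rewrite !sum_n_Sm by lia. rewrite <- IH by lia. reflexivity.
  + now rewrite !sum_n_m_zero by lia.
Qed.

Lemma Im_le_Cmod (z : C) : Rabs (Im z) <= Cmod z.
Proof. eapply Rle_trans; [|apply Rmax_Cmod]. apply Rmax_r. Qed.

Lemma Cmod_le_Re_Im (z : C) : Cmod z <= Rabs (Re z) + Rabs (Im z).
Proof.
apply Rsqr_incr_0_var.
2: { generalize (Rabs_pos (Re z)) (Rabs_pos (Im z)); lra. }
rewrite !Rsqr_pow2, Cmod2_alt, <- (pow2_abs (Re z)), <- (pow2_abs (Im z)).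
generalize (Rabs_pos (Re z)) (Rabs_pos (Im z)); nra.
Qed.

Lemma is_lim_seq_Rabs_minus (u : nat -> R) (l : R) :
  is_lim_seq u l <-> is_lim_seq (fun n => Rabs (u n - l)) 0.
Proof.
rewrite <- !is_lim_seq_spec.
split; intros H eps; destruct (H eps) as [N HN]; exists N; intros n Hn;
  specialize (HN n Hn); rewrite ?Rminus_0_r, ?Rabs_Rabsolu in *; exact HN.
Qed.

(** The link with [CSeries], which is defined coordinatewise, and the means of
    lifting results on real series to [C]. *)
Lemma is_Cseries_Re_Im (u : nat -> C) (l : C) :
  is_Cseries u l <->
  is_series (fun k => Re (u k)) (Re l) /\ is_series (fun k => Im (u k)) (Im l).
Proof.
rewrite is_Cseries_Cmod.
change (is_series (fun k => Re (u k)) (Re l))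
  with (is_lim_seq (sum_n (fun k => Re (u k))) (Re l)).
change (is_series (fun k => Im (u k)) (Im l))
  with (is_lim_seq (sum_n (fun k => Im (u k))) (Im l)).
rewrite (is_lim_seq_Rabs_minus _ (Re l)), (is_lim_seq_Rabs_minus _ (Im l)).
assert (HR : forall n, sum_n (fun k => Re (u k)) n - Re l
                       = Re (sum_n u n - l)%C).
{ intros n. unfold sum_n. now rewrite <- Re_sum_n_m. }
assert (HI : forall n, sum_n (fun k => Im (u k)) n - Im l
                       = Im (sum_n u n - l)%C).
{ intros n. unfold sum_n. now rewrite <- Im_sum_n_m. }
split.
- intros H; split; (eapply is_lim_seq_le_le; [|apply is_lim_seq_const|exact H]);
    intros n; cbv beta; split; try apply Rabs_pos.
  + rewrite HR. apply re_le_Cmod.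
  + rewrite HI. apply Im_le_Cmod.
- intros [H1 H2].
  eapply is_lim_seq_le_le; [|apply is_lim_seq_const|].
  2: { replace 0 with (0 + 0) by ring.
       apply (is_lim_seq_plus' _ _ _ _ H1 H2). }
  intros n; cbv beta; split; [apply Cmod_ge_0|].
  rewrite HR, HI. apply Cmod_le_Re_Im.
Qed.

Lemma is_Cseries_unique (u : nat -> C) (l l' : C) :
  is_Cseries u l -> is_Cseries u l' -> l = l'.
Proof.
rewrite !is_Cseries_Re_Im. intros [H1 H2] [H3 H4].
apply is_series_unique in H1, H2, H3, H4.
destruct l, l'; simpl in *; congruence.
Qed.

Lemma CSeries_unique (u : nat -> C) (l : C) :
  Cis_series u l -> CSeries u = l.
Proof.
unfold Cis_series, CSeries. rewrite is_Cseries_Re_Im. intros [H1 H2].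
apply is_series_unique in H1, H2. rewrite H1, H2. now destruct l.
Qed.

Lemma CSeries_correct (u : nat -> C) :
  ex_series (fun k => Cmod (u (S k))) -> Cis_series u (CSeries u).
Proof.
intros H.
destruct (ex_series_le (K := C_AbsRing) (V := C_CompleteNormedModule)
            (fun k => u (S k)) _ (fun k => Rle_refl _) H) as [l Hl].
change (Cis_series u l) in Hl. now rewrite (CSeries_unique _ _ Hl).
Qed.

Lemma Cmod_is_Cseries_le (u : nat -> C) (v : nat -> R) (l : C) (L : R) :
  (forall k, Cmod (u k) <= v k) -> is_Cseries u l -> is_series v L ->
  Cmod l <= L.
Proof.
intros Huv Hu Hv.
apply (filterlim_le (F := eventually) (fun n => Cmod (sum_n u n))
         (sum_n v) (Cmod l) L).
- apply filter_forall. intros n.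
  eapply Rle_trans.
  + exact (norm_sum_n_m (K := C_AbsRing) (V := C_NormedModule) u 0 n).
  + apply sum_n_m_le. intros k. apply Huv.
- eapply filterlim_comp; [exact Hu|].
  exact (filterlim_norm (K := C_AbsRing) (V := C_NormedModule) l).
- exact Hv.
Qed.

(** The real and imaginary parts of the product are combinations of four real
    Cauchy products, to which the real theorem applies. *)
Lemma is_Cseries_Cauchy_product (a b : nat -> C) (la lb : C) :
  is_Cseries a la -> is_Cseries b lb ->
  ex_series (fun k => Cmod (a k)) -> ex_series (fun k => Cmod (b k)) ->
  is_Cseries (fun n => sum_n (fun k => a k * b (n - k)%nat)%C n) (la * lb)%C.
Proof.
intros Ha Hb Haa Hbb.
assert (HRe : forall u : nat -> C, ex_series (fun k => Cmod (u k)) ->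
                ex_series (fun k => Rabs (Re (u k)))).
{ intros u. apply (ex_series_le (V := R_CompleteNormedModule)).
  intros k. unfold norm; simpl. unfold abs; simpl.
  rewrite Rabs_Rabsolu. apply re_le_Cmod. }
assert (HIm : forall u : nat -> C, ex_series (fun k => Cmod (u k)) ->
                ex_series (fun k => Rabs (Im (u k)))).
{ intros u. apply (ex_series_le (V := R_CompleteNormedModule)).
  intros k. unfold norm; simpl. unfold abs; simpl.
  rewrite Rabs_Rabsolu. apply Im_le_Cmod. }
apply is_Cseries_Re_Im in Ha as [Har Hai].
apply is_Cseries_Re_Im in Hb as [Hbr Hbi].
pose proof (is_series_mult _ _ _ _ Har Hbr (HRe _ Haa) (HRe _ Hbb)) as Hrr.
pose proof (is_series_mult _ _ _ _ Hai Hbi (HIm _ Haa) (HIm _ Hbb)) as Hii.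
pose proof (is_series_mult _ _ _ _ Har Hbi (HRe _ Haa) (HIm _ Hbb)) as Hri.
pose proof (is_series_mult _ _ _ _ Hai Hbr (HIm _ Haa) (HRe _ Hbb)) as Hir.
apply is_Cseries_Re_Im. split.
- eapply is_series_ext; [|exact (is_series_minus _ _ _ _ Hrr Hii)].
  intros n. unfold sum_n. rewrite Re_sum_n_m.
  change (sum_n_m (G := R_AbelianMonoid) ?f 0 n) with (sum_n f n).
  rewrite sum_n_Reals. change plus with Rplus. change opp with Ropp.
  rewrite <- Rminus_def, <- minus_sum. reflexivity.
- eapply is_series_ext; [|exact (is_series_plus _ _ _ _ Hri Hir)].
  intros n. unfold sum_n. rewrite Im_sum_n_m.
  change (sum_n_m (G := R_AbelianMonoid) ?f 0 n) with (sum_n f n).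
  rewrite sum_n_Reals. change plus with Rplus.
  rewrite <- plus_sum. reflexivity.
Qed.

(** * The Fejér factor at integers *)

Lemma Csum_list_app (u : nat -> C) (l l' : list nat) :
  Csum_list u (l ++ l') = (Csum_list u l + Csum_list u l')%C.
Proof.
induction l as [|d l IH]; simpl; [now rewrite Cplus_0_l|].
now rewrite IH, Cplus_assoc.
Qed.

Lemma Csum_list_ext (u v : nat -> C) (l : list nat) :
  (forall d, In d l -> u d = v d) -> Csum_list u l = Csum_list v l.
Proof.
intros H. induction l as [|d l IH]; simpl; trivial.
rewrite H by now left. rewrite IH; trivial. intros e He. apply H. now right.
Qed.

Lemma Csum_list_seq (u : nat -> C) (N : nat) :
  Csum_list u (seq 1 N) = sum_n_m u 1 N.
Proof.
induction N as [|N IH].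
- now rewrite sum_n_m_zero by lia.
- rewrite seq_S, Csum_list_app, IH, sum_n_Sm by lia.
  simpl. now rewrite Cplus_0_r.
Qed.

Lemma Csum_list_filter (u : nat -> C) (p : nat -> bool) (l : list nat) :
  Csum_list u (filter p l) =
  Csum_list (fun d => if p d then u d else RtoC 0) l.
Proof.
induction l as [|d l IH]; simpl; trivial.
destruct (p d); simpl; rewrite IH; trivial. now rewrite Cplus_0_l.
Qed.

Lemma sum_n_S (u : nat -> C) (n : nat) :
  sum_n (fun k => u (S k)) n = sum_n_m u 1 (S n).
Proof. unfold sum_n. exact (sum_n_m_S u 0 n). Qed.

(** Summing a divisibility indicator over a range that does not depend on [n]
    allows sums for different [n] to be compared; the indices beyond [n]
    contribute nothing. *)
Lemma sum_divisors_upto (u : nat -> C) (n N : nat) :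
  (1 <= n <= N)%nat ->
  Csum_list u (divisors n) =
  sum_n_m (fun d => if Nat.eqb (n mod d) 0 then u d else RtoC 0) 1 N.
Proof.
intros Hn. unfold divisors. rewrite Csum_list_filter, Csum_list_seq.
rewrite (sum_n_m_Chasles _ 1 n N) by lia.
rewrite (sum_n_m_ext_loc _ (fun _ => zero) (S n) N).
- rewrite sum_n_m_const_zero. symmetry. apply plus_zero_r.
- intros k Hk. rewrite Nat.mod_small by lia.
  destruct n; [lia|reflexivity].
Qed.

Lemma Ccos_RtoC (x : R) : Ccos (RtoC x) = RtoC (cos x).
Proof.
unfold Ccos, Cexp, Cdiv.
replace (Re (Ci * x)%C) with 0 by (simpl; ring).
replace (Im (Ci * x)%C) with x by (simpl; ring).
replace (Re (- (Ci * x))%C) with 0 by (simpl; ring).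
replace (Im (- (Ci * x))%C) with (- x) by (simpl; ring).
rewrite exp_0, cos_neg, sin_neg.
unfold Cplus, Cmult, Cinv, RtoC; simpl.
f_equal; field.
Qed.

(** This is the squared modulus of [1 + e^(it) + ... + e^(i(m-1)t)], which is
    [m] times the classical Fejér kernel. *)
Definition fejer (t : R) (m : nat) : R :=
  INR m + 2 * sum_n_m (fun k => INR (m - k) * cos (INR k * t)) 1 (m - 1).

Lemma F_RtoC (x : R) (i : nat) :
  (1 <= i)%nat -> F (RtoC x) i = RtoC (fejer (2 * PI * x / INR i) i).
Proof.
intros Hi. assert (Hi0 : INR i <> 0) by (apply not_0_INR; lia).
unfold F, fejer. rewrite Csum_list_seq, RtoC_plus, RtoC_mult.
f_equal. f_equal.
generalize (i - 1)%nat as M. induction M as [|M IH].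
- now rewrite !sum_n_m_zero by lia.
- rewrite !sum_n_Sm by lia. rewrite IH. change (@plus R_AbelianMonoid) with Rplus.
  rewrite RtoC_plus. change (@plus C_AbelianMonoid) with Cplus. f_equal.
  rewrite (RtoC_mult (INR (i - S M))). f_equal.
  rewrite <- (RtoC_mult (2 * PI * INR (S M))), <- RtoC_div by assumption.
  rewrite Ccos_RtoC.
  f_equal. f_equal. field. exact Hi0.
Qed.

(** The product formula
    [2 cos (m t) cos t = cos ((m+1) t) + cos ((m-1) t)] makes the sum telescope. *)
Lemma dirichlet_kernel_telescopes (t : R) (m : nat) :
  (1 + 2 * sum_n_m (fun k => cos (INR k * t)) 1 m) * (1 - cos t) =
  cos (INR m * t) - cos (INR (S m) * t).
Proof.
induction m as [|m IH].
- rewrite sum_n_m_zero by lia. change (@zero R_AbelianMonoid) with 0. simpl INR.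
  rewrite Rmult_0_l, cos_0, Rmult_1_l. ring.
- rewrite sum_n_Sm by lia. change (@plus R_AbelianMonoid) with Rplus.
  replace ((1 + 2 * (sum_n_m (fun k : nat => cos (INR k * t)) 1 m +
     cos (INR (S m) * t))) * (1 - cos t)) with
   ((1 + 2 * (sum_n_m (fun k : nat => cos (INR k * t)) 1 m)) * (1 - cos t) +
     2 * cos (INR (S m) * t) * (1 - cos t)) by ring.
  rewrite IH.
  replace (INR m * t) with (INR (S m) * t - t) by (rewrite S_INR; ring).
  replace (INR (S (S m)) * t) with (INR (S m) * t + t)
    by (rewrite (S_INR (S m)); ring).
  rewrite cos_minus, cos_plus. ring.
Qed.

(** The Fejér sum is a sum of Dirichlet kernels, so that their closed form can
    be summed a second time. *)
Lemma fejer_S (t : R) (m : nat) :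
  fejer t (S m) = fejer t m + (1 + 2 * sum_n_m (fun k => cos (INR k * t)) 1 m).
Proof.
unfold fejer. replace (S m - 1)%nat with m by lia.
rewrite S_INR.
assert (H : sum_n_m (fun k => INR (S m - k) * cos (INR k * t)) 1 m =
  sum_n_m (fun k => INR (m - k) * cos (INR k * t)) 1 m +
  sum_n_m (fun k => cos (INR k * t)) 1 m).
{ change Rplus with (plus (G := R_AbelianMonoid)).
  rewrite <- sum_n_m_plus. apply sum_n_m_ext_loc. intros k Hk.
  change (@plus R_AbelianMonoid) with Rplus.
  replace (S m - k)%nat with (S (m - k)) by lia. rewrite S_INR.
  match goal with |- ?x = ?y => change (@eq R x y) end. ring. }
rewrite H.
assert (H' : sum_n_m (fun k => INR (m - k) * cos (INR k * t)) 1 m =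
  sum_n_m (fun k => INR (m - k) * cos (INR k * t)) 1 (m - 1)).
{ destruct m as [|m]; [reflexivity|].
  rewrite sum_n_Sm by lia. rewrite Nat.sub_diag.
  replace (S m - 1)%nat with m by lia.
  simpl (INR 0). rewrite Rmult_0_l. apply (plus_zero_r (G := R_AbelianMonoid)). }
rewrite H'. ring.
Qed.

Lemma fejer_closed_form (t : R) (m : nat) :
  fejer t m * (1 - cos t) = 1 - cos (INR m * t).
Proof.
induction m as [|m IH].
- unfold fejer. rewrite sum_n_m_zero by (simpl; lia). simpl INR.
  change (@zero R_AbelianMonoid) with 0. rewrite Rmult_0_l, cos_0. ring.
- rewrite fejer_S, Rmult_plus_distr_r, IH, dirichlet_kernel_telescopes. ring.
Qed.

Lemma cos_2PI_INR (n : nat) : cos (2 * PI * INR n) = 1.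
Proof.
replace (2 * PI * INR n) with (0 + 2 * INR n * PI) by ring.
now rewrite cos_period, cos_0.
Qed.

(** When every cosine is 1 the Dirichlet kernels are the odd numbers, which add up
    to a square. *)
Lemma fejer_at_period (t : R) (m : nat) :
  (forall k, cos (INR k * t) = 1) -> fejer t m = INR m ^ 2.
Proof.
intros Ht. induction m as [|m IH].
- unfold fejer. rewrite sum_n_m_zero by (simpl; lia).
  change (@zero R_AbelianMonoid) with 0. simpl. ring.
- rewrite fejer_S, IH, (sum_n_m_ext _ (fun _ => 1) 1 m) by (intros; apply Ht).
  rewrite sum_n_m_const, S_INR. replace (S m - 1)%nat with m by lia. ring.
Qed.

Lemma cos_eq_1 (x : R) : cos x = 1 -> exists k : Z, x = 2 * PI * IZR k.
Proof.
intros H.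
assert (Hs : sin (x / 2) = 0).
{ replace x with (2 * (x / 2)) in H by field.
  rewrite cos_2a_sin in H. nra. }
destruct (sin_eq_0_0 _ Hs) as [k Hk]. exists k. lra.
Qed.

Lemma fejer_at_integer (n i : nat) :
  (1 <= i)%nat ->
  fejer (2 * PI * INR n / INR i) i =
  if Nat.eqb (n mod i) 0 then INR i ^ 2 else 0.
Proof.
intros Hi. assert (Hi0 : INR i <> 0) by (apply not_0_INR; lia).
destruct (Nat.eqb_spec (n mod i) 0) as [E|E].
- apply fejer_at_period. intros k.
  apply Nat.Div0.div_exact in E. rewrite E at 1.
  rewrite <- (cos_2PI_INR (k * (n / i))), !mult_INR. f_equal. now field.
- pose proof (fejer_closed_form (2 * PI * INR n / INR i) i) as H.
  replace (INR i * (2 * PI * INR n / INR i)) with (2 * PI * INR n) in H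
    by now field.
  rewrite cos_2PI_INR in H.
  destruct (Rmult_integral _ _ ltac:(rewrite H; ring)) as [H'|H']; trivial.
  (* Otherwise [t] is a multiple of [2 pi], which says that [i] divides [n]. *)
  exfalso. apply E.
  destruct (cos_eq_1 (2 * PI * INR n / INR i)) as [k Hk]; [lra|].
  assert (Hn : IZR (Z.of_nat n) = IZR (k * Z.of_nat i)).
  { rewrite mult_IZR, <- !INR_IZR_INZ.
    apply (Rmult_eq_reg_l (2 * PI)); [|generalize PI_RGT_0; lra].
    replace (2 * PI * INR n) with (2 * PI * INR n / INR i * INR i) by now field.
    rewrite Hk. ring. }
  apply eq_IZR in Hn.
  apply Nat2Z.inj. rewrite Nat2Z.inj_mod, Hn. now rewrite Z.mod_mul by lia.
Qed.

Lemma lift_term_at_integer (a : nat -> C) (n i : nat) :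
  (1 <= i)%nat ->
  lift_term a (RtoC (INR n)) i =
  if Nat.eqb (n mod i) 0 then a i else RtoC 0.
Proof.
intros Hi. unfold lift_term. rewrite F_RtoC, fejer_at_integer by assumption.
destruct (Nat.eqb_spec (n mod i) 0) as [E|E].
- field. intros H. apply RtoC_inj in H.
  revert H. apply pow_nonzero, not_0_INR. lia.
- apply Cmult_0_r.
Qed.

Lemma lift_series_at_integer (a : nat -> C) (n : nat) :
  (1 <= n)%nat ->
  Cis_series (lift_term a (RtoC (INR n))) (Csum_list a (divisors n)).
Proof.
intros Hn. apply is_Cseries_Cmod.
apply is_lim_seq_ext_loc with (fun _ => 0); [|apply is_lim_seq_const].
exists n. intros N HN.
rewrite sum_n_S, (sum_divisors_upto a n (S N)) by lia.
rewrite (sum_n_m_ext_loc _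
  (fun d => if Nat.eqb (n mod d) 0 then a d else RtoC 0) 1 (S N)).
- rewrite <- Cmod_0. f_equal. symmetry. apply Cplus_opp_r.
- intros k Hk. apply lift_term_at_integer. lia.
Qed.

Lemma dirichlet_conv_one (a : nat -> C) (n : nat) :
  dirichlet_conv a one_fun n = Csum_list a (divisors n).
Proof. apply Csum_list_ext. intros d _. apply Cmult_1_r. Qed.

(** * Dirichlet products *)

(** The quotient [N / d] counts the multiples of [d] up to [N]. *)
Lemma div_S_step (N d : nat) :
  (1 <= d)%nat ->
  (S N / d = if Nat.eqb (S N mod d) 0 then S (N / d) else N / d)%nat.
Proof.
intros Hd. pose proof (Nat.div_mod_eq (S N) d) as H.
pose proof (Nat.mod_upper_bound (S N) d ltac:(lia)) as Hr.
set (q := (S N / d)%nat) in *. set (r := (S N mod d)%nat) in *.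
destruct (Nat.eqb_spec r 0) as [E|E].
- destruct q as [|q]; [lia|]. f_equal.
  apply (Nat.div_unique N d q (d - 1)); lia.
- apply (Nat.div_unique N d q (r - 1)); lia.
Qed.

(** Both sides sum [x d * y k] over the pairs with [d * k <= N].  By induction on
    [N]: the new pairs are those with [d * k = N + 1], because [N / d] increases
    exactly when [d] divides [N + 1]. *)
Lemma hyperbola_sum (x y : nat -> C) (N : nat) :
  sum_n_m (fun n => Csum_list (fun d => x d * y (n / d)%nat)%C (divisors n)) 1 N =
  sum_n_m (fun d => x d * sum_n_m y 1 (N / d)%nat)%C 1 N.
Proof.
induction N as [|N IH].
- now rewrite !sum_n_m_zero by lia.
- rewrite sum_n_Sm, IH by lia. rewrite (sum_divisors_upto _ (S N) (S N)) by lia.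
  transitivity (sum_n_m (fun d => plus (x d * sum_n_m y 1 (N / d)%nat)%C
    (if Nat.eqb (S N mod d) 0 then x d * y (S N / d)%nat else RtoC 0)%C) 1 (S N)).
  + rewrite sum_n_m_plus. f_equal.
    rewrite (sum_n_Sm (fun d => x d * sum_n_m y 1 (N / d)%nat)%C) by lia.
    rewrite (Nat.div_small N (S N)), (sum_n_m_zero y 1 0) by lia.
    change (@zero C_AbelianMonoid) with (RtoC 0).
    rewrite Cmult_0_r. exact (eq_sym (Cplus_0_r _)).
  + apply sum_n_m_ext_loc. intros d Hd.
    rewrite (div_S_step N d) by lia.
    destruct (Nat.eqb (S N mod d) 0).
    * rewrite sum_n_Sm by lia. symmetry. apply Cmult_plus_distr_l.
    * exact (Cplus_0_r _).
Qed.

Lemma sum_n_m_le_loc (a b : nat -> R) (n m : nat) :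
  (forall k, (n <= k <= m)%nat -> a k <= b k) ->
  sum_n_m a n m <= sum_n_m b n m.
Proof.
intros H. rewrite (sum_n_m_ext_loc b (fun k => Rmax (a k) (b k))).
- apply sum_n_m_le. intros k. apply Rmax_l.
- intros k Hk. symmetry. now apply Rmax_right, H.
Qed.

Lemma is_series_from_1 (p : nat -> R) (P : R) :
  is_series (fun k => p (S k)) P <-> is_lim_seq (sum_n_m p 1) P.
Proof.
change (is_series (fun k => p (S k)) P)
  with (is_lim_seq (sum_n (fun k => p (S k))) P).
rewrite (is_lim_seq_incr_1 (sum_n_m p 1)).
split; apply is_lim_seq_ext; intros n; [|symmetry]; exact (sum_n_m_S p 0 n).
Qed.

Lemma Cis_series_sum_from_1 (u : nat -> C) (l : C) :
  Cis_series u l <-> is_lim_seq (fun N => Cmod (sum_n_m u 1 N - l)) 0.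
Proof.
unfold Cis_series. rewrite is_Cseries_Cmod.
rewrite (is_lim_seq_incr_1 (fun N => Cmod (sum_n_m u 1 N - l))).
split; apply is_lim_seq_ext; intros n; now rewrite sum_n_S.
Qed.

(** Cut the sum at [K = N / M].  For [d <= K] the argument [N / d] is at least [M],
    where [t] is small; for [d > K] the function [t] is only bounded, but the
    remaining weights are part of a tail of a convergent series. *)
Lemma weighted_tails_vanish (p t : nat -> R) (P : R) :
  (forall d, 0 <= p d) -> is_series (fun k => p (S k)) P ->
  (forall m, 0 <= t m) -> is_lim_seq t 0 ->
  is_lim_seq (fun N => sum_n_m (fun d => p d * t (N / d)%nat) 1 N) 0.
Proof.
intros Hp HP Ht Ht0.
destruct (filterlim_bounded (K := R_AbsRing) (V := R_NormedModule) t
            (ex_intro _ 0 Ht0)) as [T HT].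
assert (HT' : forall m, t m <= T).
{ intros m. eapply Rle_trans; [apply Rle_abs|apply HT]. }
assert (T0 : 0 <= T) by (eapply Rle_trans; [apply (Ht 0%nat)|apply HT']).
apply is_series_from_1 in HP.
assert (HSP : forall N, sum_n_m p 1 N <= P).
{ apply (is_lim_seq_incr_compare _ _ HP). intros n. rewrite sum_n_Sm by lia.
  change (@plus R_AbelianMonoid) with Rplus. specialize (Hp (S n)). lra. }
assert (P0 : 0 <= P).
{ specialize (HSP 0%nat). now rewrite sum_n_m_zero in HSP by lia. }
rewrite <- is_lim_seq_spec in *. intros eps.
(* The [+ 1] keeps the denominators positive when [P] or [T] is 0 and makes
   each half strictly less than [eps / 2]. *)
assert (e1 : 0 < eps / (2 * (P + 1))).
{ apply Rdiv_lt_0_compat; [apply cond_pos|lra]. }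
assert (e2 : 0 < eps / (2 * (T + 1))).
{ apply Rdiv_lt_0_compat; [apply cond_pos|lra]. }
destruct (Ht0 (mkposreal _ e1)) as [M0 HM]. simpl in HM.
destruct (HP (mkposreal _ e2)) as [K0 HK]. simpl in HK.
set (M := S M0). exists (M * K0)%nat. intros N HN.
set (K := (N / M)%nat).
assert (HK0 : (K0 <= K)%nat) by (apply Nat.div_le_lower_bound; lia).
assert (HKN : (K <= N)%nat) by (apply Nat.Div0.div_le_upper_bound; nia).
rewrite Rminus_0_r, Rabs_pos_eq.
2: { rewrite <- (Rmult_0_r (INR (S N - 1))), <- (sum_n_m_const 1 N 0).
     apply sum_n_m_le. intros k. now apply Rmult_le_pos. }
rewrite (sum_n_m_Chasles _ 1 K N) by lia.
assert (B1 : sum_n_m (fun d => p d * t (N / d)%nat) 1 K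
             <= eps / (2 * (P + 1)) * P).
{ apply Rle_trans with (eps / (2 * (P + 1)) * sum_n_m p 1 K).
  2: { apply Rmult_le_compat_l; [lra|apply HSP]. }
  eapply Rle_trans;
    [|right; exact (sum_n_m_mult_l (K := R_Ring) (eps / (2 * (P + 1))) p 1 K)].
  apply sum_n_m_le_loc. intros d Hd.
  change (@mult R_Ring) with Rmult. rewrite Rmult_comm.
  apply Rmult_le_compat_r; [apply Hp|].
  assert (HNd : (M0 <= N / d)%nat).
  { apply Nat.div_le_lower_bound; [lia|].
    pose proof (Nat.Div0.mul_div_le N M). fold K in H. subst M. nia. }
  specialize (HM _ HNd). rewrite Rminus_0_r in HM.
  generalize (Rle_abs (t (N / d)%nat)); lra. }
assert (B2 : sum_n_m (fun d => p d * t (N / d)%nat) (S K) N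
             <= T * (eps / (2 * (T + 1)))).
{ apply Rle_trans with (T * sum_n_m p (S K) N).
  - eapply Rle_trans;
      [|right; exact (sum_n_m_mult_l (K := R_Ring) T p (S K) N)].
    apply sum_n_m_le. intros d.
    change (@mult R_Ring) with Rmult. rewrite Rmult_comm.
    apply Rmult_le_compat_r; [apply Hp|apply HT'].
  - apply Rmult_le_compat_l; trivial.
    pose proof (sum_n_m_Chasles p 1 K N ltac:(lia) HKN) as H.
    change (@plus R_AbelianMonoid) with Rplus in H.
    specialize (HSP N). specialize (HK _ HK0).
    apply Rabs_def2 in HK. lra. }
change (@plus R_AbelianMonoid) with Rplus.
eapply Rle_lt_trans; [exact (Rplus_le_compat _ _ _ _ B1 B2)|].
assert (F1 : eps / (2 * (P + 1)) * P < eps / 2).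
{ apply Rlt_0_minus.
  replace (eps / 2 - eps / (2 * (P + 1)) * P) with (eps / (2 * (P + 1)))
    by (field; lra). exact e1. }
assert (F2 : T * (eps / (2 * (T + 1))) < eps / 2).
{ apply Rlt_0_minus.
  replace (eps / 2 - T * (eps / (2 * (T + 1)))) with (eps / (2 * (T + 1)))
    by (field; lra). exact e2. }
lra.
Qed.

(** Absolute convergence of one factor suffices, as in the theorem of Mertens on
    Cauchy products: with [X_N], [Y_N] the partial sums, the difference to the
    limit is [sum_(d <= N) x_d (Y_(N / d) - Y) + (X_N - X) Y]. *)
Lemma dirichlet_product (x y : nat -> C) (X Y : C) :
  ex_series (fun k => Cmod (x (S k))) ->
  Cis_series x X -> Cis_series y Y ->
  Cis_series (fun n => Csum_list (fun d => x d * y (n / d)%nat)%C (divisors n))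
    (X * Y)%C.
Proof.
intros [P HP] HX HY.
rewrite Cis_series_sum_from_1 in *.
pose proof (weighted_tails_vanish (fun d => Cmod (x d)) _ P
  (fun d => Cmod_ge_0 _) HP (fun m => Cmod_ge_0 _) HY) as H1.
pose proof (is_lim_seq_scal_r _ (Cmod Y) _ HX) as H2.
simpl in H2. rewrite Rmult_0_l in H2.
pose proof (is_lim_seq_plus' _ _ _ _ H1 H2) as H. rewrite Rplus_0_l in H.
eapply is_lim_seq_le_le; [|apply is_lim_seq_const|exact H].
intros N. split; [apply Cmod_ge_0|]. cbv beta.
rewrite hyperbola_sum, <- Cmod_mult.
assert (E : (sum_n_m (fun d => x d * sum_n_m y 1 (N / d)%nat)%C 1 N - X * Y =
  sum_n_m (fun d => x d * (sum_n_m y 1 (N / d)%nat - Y))%C 1 N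
  + (sum_n_m x 1 N - X) * Y)%C).
{ rewrite (sum_n_m_ext (fun d => x d * sum_n_m y 1 (N / d)%nat)%C
    (fun d => plus (x d * (sum_n_m y 1 (N / d)%nat - Y))%C (x d * Y)%C)).
  - rewrite sum_n_m_plus.
    assert (E : sum_n_m (fun d => (x d * Y)%C) 1 N = (sum_n_m x 1 N * Y)%C)
      by exact (sum_n_m_mult_r (K := C_Ring) Y x 1 N).
    rewrite E. change (@plus C_AbelianMonoid) with Cplus. ring.
  - intros d. change (@plus C_AbelianMonoid) with Cplus.
    match goal with |- ?u = ?v => change (@eq C u v) end. ring. }
rewrite E. eapply Rle_trans; [apply Cmod_triangle|].
apply Rplus_le_compat_r.
eapply Rle_trans;
  [exact (norm_sum_n_m (K := C_AbsRing) (V := C_NormedModule) _ 1 N)|].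
apply sum_n_m_le. intros d. right. apply Cmod_mult.
Qed.

(** * Dirichlet series of divisor sums *)

Lemma Cexp_plus (z w : C) : Cexp (z + w) = (Cexp z * Cexp w)%C.
Proof.
destruct z as [a b], w as [c d]. unfold Cexp, Cmult; simpl.
rewrite exp_plus, cos_plus, sin_plus. f_equal; ring.
Qed.

Lemma Cmod_Cexp (z : C) : Cmod (Cexp z) = exp (Re z).
Proof.
unfold Cexp, Cmod; cbn [fst snd].
replace (_ + _) with (exp (Re z) ^ 2 * (Rsqr (sin (Im z)) + Rsqr (cos (Im z))))
  by (unfold Rsqr; ring).
rewrite sin2_cos2, Rmult_1_r. apply sqrt_pow2. left. apply exp_pos.
Qed.

Lemma nat_cpow_neq_0 (n : nat) (s : C) : nat_cpow n s <> 0.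
Proof.
apply Cmod_gt_0. unfold nat_cpow. rewrite Cmod_Cexp. apply exp_pos.
Qed.

Lemma nat_cpow_mult (n m : nat) (s : C) :
  (1 <= n)%nat -> (1 <= m)%nat ->
  nat_cpow (n * m) s = (nat_cpow n s * nat_cpow m s)%C.
Proof.
intros Hn Hm. unfold nat_cpow.
rewrite mult_INR, ln_mult by (apply lt_0_INR; lia).
rewrite <- Cexp_plus, RtoC_plus. f_equal. ring.
Qed.

(** Writing [delta m^(-1-delta) <= (m-1)^(-delta) - m^(-delta)] in this form
    bounds the terms of the zeta series by differences.  It follows from
    [exp y >= 1 + y] and [ln m - ln (m - 1) >= 1 / m]. *)
Lemma Rpower_neg_telescopes (delta m : R) :
  0 < delta -> 1 < m ->
  delta * exp (- ((1 + delta) * ln m)) + exp (- (delta * ln m)) <=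
  exp (- (delta * ln (m - 1))).
Proof.
intros Hd Hm.
replace (- ((1 + delta) * ln m)) with (- (delta * ln m) + - ln m) by ring.
replace (- (delta * ln (m - 1))) with
  (- (delta * ln m) + delta * (ln m - ln (m - 1))) by ring.
rewrite !exp_plus, exp_Ropp, exp_Ropp, exp_ln by lra.
assert (Hlog : / m <= ln m - ln (m - 1)).
{ assert (H : ln ((m - 1) / m) <= - / m).
  { rewrite <- (ln_exp (- / m)). apply ln_le.
    - apply Rdiv_lt_0_compat; lra.
    - replace ((m - 1) / m) with (1 + - / m) by (field; lra).
      apply exp_ineq1_le. }
  rewrite ln_div in H by lra. lra. }
pose proof (exp_ineq1_le (delta * (ln m - ln (m - 1)))) as He.
assert (0 < / exp (delta * ln m)) by apply Rinv_0_lt_compat, exp_pos.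
assert (0 < / m) by (apply Rinv_0_lt_compat; lra).
assert (delta * / m <= delta * (ln m - ln (m - 1))) by nra.
nra.
Qed.

Lemma zeta_abs_conv (s : C) : 1 < Re s -> dirichlet_abs_conv one_fun s.
Proof.
intros Hs. set (delta := Re s - 1).
assert (Hd : 0 < delta) by (unfold delta; lra).
unfold dirichlet_abs_conv.
apply ex_series_ext with (fun k => exp (- ((1 + delta) * ln (INR (S k))))).
{ intros k. unfold dirichlet_term, one_fun.
  rewrite Cmod_div by apply nat_cpow_neq_0.
  unfold nat_cpow. rewrite Cmod_Cexp, Cmod_1, exp_Ropp.
  unfold Rdiv. rewrite Rmult_1_l. f_equal. f_equal.
  unfold delta. destruct s; simpl. ring. }
destruct (ex_finite_lim_seq_incr
  (sum_n (fun k => exp (- ((1 + delta) * ln (INR (S k)))))) (1 + / delta))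
  as [l Hl].
- intros n. rewrite sum_Sn. change (@plus R_AbelianMonoid) with Rplus.
  generalize (exp_pos (- ((1 + delta) * ln (INR (S (S n)))))); lra.
(* The added term is the telescoped remainder that the induction needs. *)
- enough (Hb : forall n,
    sum_n (fun k => exp (- ((1 + delta) * ln (INR (S k))))) n
    + / delta * exp (- (delta * ln (INR (S n)))) <= 1 + / delta).
  { intros n. specialize (Hb n).
    assert (0 < / delta) by now apply Rinv_0_lt_compat.
    generalize (exp_pos (- (delta * ln (INR (S n))))). nra. }
  induction n as [|n IH].
  + rewrite sum_O. simpl INR. rewrite ln_1, !Rmult_0_r, Ropp_0, exp_0. lra.
  + rewrite sum_Sn. change (@plus R_AbelianMonoid) with Rplus.
    pose proof (Rpower_neg_telescopes delta (INR (S (S n))) Hd) as Ht.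
    rewrite (S_INR (S n)) in Ht at 1.
    specialize (Ht ltac:(generalize (lt_0_INR (S n) ltac:(lia)); lra)).
    replace (INR (S (S n)) - 1) with (INR (S n)) in Ht
      by (rewrite (S_INR (S n)); ring).
    assert (Hi : 0 < / delta) by now apply Rinv_0_lt_compat.
    apply (Rmult_le_compat_l (/ delta)) in Ht; [|lra].
    rewrite Rmult_plus_distr_l, <- Rmult_assoc, Rinv_l, Rmult_1_l in Ht by lra.
    lra.
- now exists l.
Qed.

(** The power [n^s] is completely multiplicative, so each divisor [d] of [n]
    contributes [(a d / d^s) * (1 / (n / d)^s) = a d / n^s]. *)
Lemma dirichlet_series_divisor_sum (a : nat -> C) (s : C) :
  1 < Re s -> dirichlet_abs_conv a s ->
  Cis_series (dirichlet_term (fun n => Csum_list a (divisors n)) s)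
    (zeta s * dirichlet_series a s)%C.
Proof.
intros Hs Ha. rewrite Cmult_comm.
pose proof (dirichlet_product _ _ _ _ Ha (CSeries_correct _ Ha)
  (CSeries_correct _ (zeta_abs_conv s Hs))) as H.
revert H. apply is_series_ext. intros k. set (n := S k).
unfold dirichlet_term, Cdiv.
transitivity (Csum_list (fun d => a d * / nat_cpow n s)%C (divisors n)).
- apply Csum_list_ext. intros d Hd. unfold divisors in Hd.
  apply filter_In in Hd as [Hd Hdiv]. apply in_seq in Hd.
  apply Nat.eqb_eq in Hdiv.
  apply Nat.Div0.div_exact in Hdiv.
  assert ((1 <= n / d)%nat) by (apply Nat.div_le_lower_bound; lia).
  replace (nat_cpow n s) with (nat_cpow d s * nat_cpow (n / d) s)%C
    by (rewrite <- nat_cpow_mult by lia; now rewrite <- Hdiv).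
  unfold one_fun. field. split; apply nat_cpow_neq_0.
- induction (divisors n) as [|d l IH]; simpl; [ring|]. rewrite IH. ring.
Qed.

(** * Analytic functions of a complex variable *)

Lemma pow_n_Cpow (z : C) (k : nat) : pow_n (K := C_Ring) z k = (z ^ k)%C.
Proof. induction k as [|k IH]; simpl; [reflexivity|]. now rewrite IH. Qed.

Lemma is_Cpseries_Cpow (c : nat -> C) (z l : C) :
  is_Cpseries c z l <->
  is_Cseries (fun k => z ^ k * c k)%C l.
Proof.
unfold is_pseries.
split; apply is_series_ext; intros k; [|symmetry];
  exact (f_equal (fun w => w * c k)%C (pow_n_Cpow z k)).
Qed.

Lemma is_Cseries_bounded (u : nat -> C) (l : C) :
  is_Cseries u l -> exists M, 0 <= M /\ forall k, Cmod (u k) <= M.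
Proof.
intros H.
destruct (filterlim_bounded (K := C_AbsRing) (V := C_NormedModule) (sum_n u)
            (ex_intro _ l H)) as [B HB].
assert (HB' : forall n, Cmod (sum_n u n) <= B) by exact HB.
assert (B0 : 0 <= B) by (eapply Rle_trans; [apply Cmod_ge_0|apply (HB' 0%nat)]).
exists (2 * B). split; [lra|]. intros [|k].
- specialize (HB' 0%nat). rewrite sum_O in HB'. lra.
- replace (u (S k)) with (sum_n u (S k) + - sum_n u k)%C.
  + eapply Rle_trans; [apply Cmod_triangle|]. rewrite Cmod_opp.
    generalize (HB' (S k)) (HB' k). lra.
  + rewrite sum_Sn. change (@plus C_AbelianMonoid) with Cplus. ring.
Qed.

(** Convergence at radius [rho] bounds the terms there, which gives geometric
    domination on every smaller disc. *)
Lemma Cauchy_estimate (c : nat -> C) (rho : R) (l : C) :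
  0 < rho -> is_Cpseries c (RtoC rho) l ->
  exists M, 0 <= M /\
    forall z k, Cmod (z ^ k * c k)%C <= M * (Cmod z / rho) ^ k.
Proof.
intros Hrho H. apply is_Cpseries_Cpow, is_Cseries_bounded in H as [M [HM0 HM]].
exists M. split; trivial. intros z k. specialize (HM k).
rewrite Cmod_mult, Cmod_pow, Cmod_R, Rabs_pos_eq in HM by lra.
rewrite Cmod_mult, Cmod_pow.
replace (Cmod z ^ k * Cmod (c k))
  with (rho ^ k * Cmod (c k) * (Cmod z / rho) ^ k).
- apply Rmult_le_compat_r; trivial.
  apply pow_le, Rle_mult_inv_pos; [apply Cmod_ge_0|trivial].
- unfold Rdiv. rewrite Rpow_mult_distr, pow_inv. field.
  apply pow_nonzero. lra.
Qed.

Lemma is_Cpseries_abs_conv (c : nat -> C) (rho : R) (l z : C) :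
  Cmod z < rho ->
  is_Cpseries c (RtoC rho) l ->
  ex_series (fun k => Cmod (z ^ k * c k)%C).
Proof.
intros Hz H. pose proof (Cmod_ge_0 z) as Hz0.
destruct (Cauchy_estimate c rho l ltac:(lra) H) as [M [_ HM]].
assert (Hq : Rabs (Cmod z / rho) < 1).
{ rewrite Rabs_pos_eq by (apply Rle_mult_inv_pos; lra).
  apply Rlt_div_l; lra. }
apply (ex_series_le (K := R_AbsRing) (V := R_CompleteNormedModule) _
         (fun k => M * (Cmod z / rho) ^ k)).
- intros k. change (Rabs (Cmod (z ^ k * c k)) <= M * (Cmod z / rho) ^ k).
  rewrite Rabs_pos_eq by apply Cmod_ge_0. apply HM.
- apply (ex_series_scal_l (V := R_NormedModule) M (fun k => (Cmod z / rho) ^ k)).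
  apply ex_series_geom, Hq.
Qed.

Lemma Cmod_shift (s0 : C) (rho : R) :
  0 <= rho -> (s0 + RtoC rho - s0)%C = RtoC rho /\ Cmod (s0 + RtoC rho - s0) = rho.
Proof.
intros H. assert (E : (s0 + RtoC rho - s0)%C = RtoC rho) by ring.
split; trivial. now rewrite E, Cmod_R, Rabs_pos_eq.
Qed.

(** A power series converges absolutely inside its disc of convergence: compare
    with the series at the radius halfway to the boundary. *)
Lemma analytic_at_abs_conv (f : C -> C) (s0 : C) (c : nat -> C) (r : R) :
  (forall s, Cmod (s - s0) < r ->
     is_Cpseries c (s - s0)%C (f s)) ->
  forall s, Cmod (s - s0) < r ->
    is_Cseries (fun k => (s - s0) ^ k * c k)%C (f s) /\
    ex_series (fun k => Cmod ((s - s0) ^ k * c k)%C).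
Proof.
intros H s Hs. split; [now apply is_Cpseries_Cpow, H|].
pose proof (Cmod_ge_0 (s - s0)) as H0.
set (rho := (Cmod (s - s0) + r) / 2).
destruct (Cmod_shift s0 rho ltac:(unfold rho; lra)) as [E1 E2].
apply (is_Cpseries_abs_conv c rho (f (s0 + RtoC rho)%C)).
- unfold rho; lra.
- specialize (H (s0 + RtoC rho)%C). rewrite E2, E1 in H. apply H. unfold rho; lra.
Qed.

Lemma analytic_at_mult (f g : C -> C) (s0 : C) :
  analytic_at f s0 -> analytic_at g s0 ->
  analytic_at (fun s => f s * g s)%C s0.
Proof.
intros (c & r & Hr & Hc) (d & r' & Hr' & Hd).
exists (fun n => sum_n (fun k => c k * d (n - k)%nat)%C n), (Rmin r r').
split; [now apply Rmin_glb_lt|]. intros s Hs.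
destruct (analytic_at_abs_conv f s0 c r Hc s) as [F1 F2].
{ eapply Rlt_le_trans; [exact Hs|apply Rmin_l]. }
destruct (analytic_at_abs_conv g s0 d r' Hd s) as [G1 G2].
{ eapply Rlt_le_trans; [exact Hs|apply Rmin_r]. }
apply is_Cpseries_Cpow.
eapply is_series_ext; [|exact (is_Cseries_Cauchy_product _ _ _ _ F1 G1 F2 G2)].
intros n. cbv beta.
transitivity (sum_n (fun k => ((s - s0) ^ n * (c k * d (n - k)%nat))%C) n).
- apply sum_n_m_ext_loc. intros k Hk.
  replace ((s - s0) ^ n)%C with ((s - s0) ^ k * (s - s0) ^ (n - k))%C.
  + match goal with |- ?u = ?v => change (@eq C u v) end. ring.
  + rewrite <- Cpow_add_r. f_equal. lia.
- exact (sum_n_mult_l (K := C_Ring) _ _ n).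
Qed.

Lemma analytic_at_minus (f g : C -> C) (s0 : C) :
  analytic_at f s0 -> analytic_at g s0 ->
  analytic_at (fun s => f s - g s)%C s0.
Proof.
intros (c & r & Hr & Hc) (d & r' & Hr' & Hd).
exists (fun n => c n - d n)%C, (Rmin r r').
split; [now apply Rmin_glb_lt|]. intros s Hs.
apply is_Cpseries_Cpow.
specialize (Hc s (Rlt_le_trans _ _ _ Hs (Rmin_l _ _))).
specialize (Hd s (Rlt_le_trans _ _ _ Hs (Rmin_r _ _))).
rewrite is_Cpseries_Cpow in Hc, Hd.
eapply is_series_ext; [|exact (is_series_minus _ _ _ _ Hc Hd)].
intros n. change (@plus _) with Cplus. change (@opp _) with Copp.
match goal with |- ?u = ?v => change (@eq C u v) end. cbv beta. ring.
Qed.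

Lemma is_Cseries_zero (u : nat -> C) (l : C) :
  (forall k, u k = 0) -> is_Cseries u l -> l = 0.
Proof.
intros Hu H. apply (is_Cseries_unique u); trivial.
apply is_Cseries_Cmod.
apply is_lim_seq_ext with (fun _ => 0); [|apply is_lim_seq_const].
intros n. unfold sum_n. rewrite (sum_n_m_ext _ (fun _ => zero)) by exact Hu.
rewrite sum_n_m_const_zero. symmetry.
transitivity (Cmod 0); [f_equal; exact (Cplus_opp_r 0)|apply Cmod_0].
Qed.

(** Let [c m] be the first nonzero coefficient.  Close to [s0] the term of index
    [m] dominates: at distance [x] the rest of the series is at most
    [2 M (x / rho)^(m+1)], so a zero other
    than [s0] forces [|c m| rho^(m+1) <= 2 M x], a lower bound on [x]. *)
Lemma isolated_zeros (h : C -> C) (s0 : C) :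
  analytic_at h s0 ->
  (exists r, 0 < r /\ forall s, Cmod (s - s0) < r -> h s = 0) \/
  (exists r, 0 < r /\ forall s, 0 < Cmod (s - s0) < r -> h s <> 0).
Proof.
intros (c & r & Hr & Hc).
destruct (classic (forall k, c k = 0)) as [H0|H0].
- left. exists r. split; trivial. intros s Hs.
  specialize (Hc s Hs). rewrite is_Cpseries_Cpow in Hc.
  apply is_Cseries_zero in Hc; trivial. intros k. rewrite H0. apply Cmult_0_r.
- right.
  assert (Hm : exists m, c m <> 0 /\ forall k, (k < m)%nat -> c k = 0).
  { apply not_all_ex_not in H0 as [n Hn]. revert Hn.
    induction n as [n IH] using lt_wf_ind. intros Hn.
    destruct (classic (exists k, (k < n)%nat /\ c k <> 0)) as [[k [H1 H2]]|H1].
    - now apply (IH k).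
    - exists n. split; trivial. intros k Hk.
      apply NNPP. intros H2. apply H1. now exists k. }
  destruct Hm as [m [Hcm Hlow]].
  set (rho := r / 2). assert (Hrho : 0 < rho) by (unfold rho; lra).
  destruct (Cmod_shift s0 rho ltac:(lra)) as [E1 E2].
  pose proof (Hc (s0 + RtoC rho)%C) as Hrc. rewrite E2, E1 in Hrc.
  destruct (Cauchy_estimate c rho _ Hrho (Hrc ltac:(unfold rho; lra)))
    as [M [HM0 HM]].
  apply Cmod_gt_0 in Hcm.
  set (r1 := Cmod (c m) * rho ^ S m / (2 * (M + 1))).
  assert (Hr1 : 0 < r1).
  { apply Rdiv_lt_0_compat; [|lra]. apply Rmult_lt_0_compat; trivial.
    now apply pow_lt. }
  exists (Rmin (rho / 2) r1). split; [apply Rmin_glb_lt; lra|].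
  intros s [Hs0 Hs] Hh.
  assert (Hs1 : Cmod (s - s0) < rho / 2)
    by (eapply Rlt_le_trans; [exact Hs|apply Rmin_l]).
  assert (Hs2 : Cmod (s - s0) < r1)
    by (eapply Rlt_le_trans; [exact Hs|apply Rmin_r]).
  assert (Hsr : Cmod (s - s0) < r) by (unfold rho in *; lra).
  specialize (Hc s Hsr). rewrite is_Cpseries_Cpow in Hc.
  set (z := (s - s0)%C) in *. set (q := Cmod z / rho) in *.
  assert (Hq : 0 <= q <= / 2).
  { unfold q. split; [apply Rle_mult_inv_pos; lra|].
    apply Rle_div_l; lra. }
  assert (Hsum : sum_n (fun k => z ^ k * c k)%C m = (z ^ m * c m)%C).
  { clear - Hlow. destruct m as [|m]; [now rewrite sum_O|].
    rewrite sum_Sn. unfold sum_n.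
    rewrite (sum_n_m_ext_loc _ (fun _ => zero) 0 m).
    - rewrite sum_n_m_const_zero. exact (Cplus_0_l _).
    - intros k Hk. rewrite Hlow by lia. apply Cmult_0_r. }
  (* At a zero of [h] the tail equals the opposite of the leading term. *)
  assert (Htail : is_Cseries (fun k => z ^ (S m + k) * c (S m + k)%nat)%C
                    (- (z ^ m * c m))%C).
  { apply (is_series_incr_n (V := C_NormedModule) (fun k => z ^ k * c k)%C);
      [lia|].
    rewrite Hh in Hc. replace (plus _ _) with (RtoC 0); [exact Hc|].
    transitivity (- (z ^ m * c m) + z ^ m * c m)%C; [ring|].
    exact (f_equal (Cplus _) (eq_sym Hsum)). }
  assert (Hgeom : is_series (fun k => M * q ^ S m * q ^ k)
                    (M * q ^ S m * / (1 - q))).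
  { apply (is_series_scal_l (V := R_NormedModule) (M * q ^ S m) (pow q)).
    apply is_series_geom.
    rewrite Rabs_pos_eq; lra. }
  assert (Hterm : forall k, Cmod (z ^ (S m + k) * c (S m + k)%nat)%C
                            <= M * q ^ S m * q ^ k).
  { intros k. rewrite Rmult_assoc, <- pow_add. apply HM. }
  pose proof (Cmod_is_Cseries_le _ _ _ _ Hterm Htail Hgeom) as Hle.
  rewrite Cmod_opp, Cmod_mult, Cmod_pow in Hle.
  assert (Hqm : 0 <= M * q ^ S m) by (apply Rmult_le_pos; trivial; apply pow_le; lra).
  assert (Hinv : / (1 - q) <= 2).
  { rewrite <- (Rinv_inv 2). apply Rinv_le_contravar; lra. }
  assert (Hle2 : Cmod z ^ m * Cmod (c m) <= M * q ^ S m * 2).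
  { eapply Rle_trans; [exact Hle|]. now apply Rmult_le_compat_l. }
  assert (Hzm : 0 < Cmod z ^ m) by now apply pow_lt.
  assert (Hrm : 0 < rho ^ S m) by now apply pow_lt.
  assert (Hq2 : q ^ S m * rho ^ S m = Cmod z ^ m * Cmod z).
  { rewrite <- Rpow_mult_distr. unfold q.
    replace (Cmod z / rho * rho) with (Cmod z) by (field; lra). simpl; ring. }
  assert (Hle3 : Cmod (c m) * rho ^ S m <= 2 * M * Cmod z).
  { apply (Rmult_le_reg_l (Cmod z ^ m)); trivial.
    replace (Cmod z ^ m * (2 * M * Cmod z))
      with (2 * M * (q ^ S m * rho ^ S m)) by (rewrite Hq2; ring).
    apply (Rmult_le_compat_r (rho ^ S m)) in Hle2; lra. }
  assert (Hr1' : r1 * (2 * (M + 1)) = Cmod (c m) * rho ^ S m).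
  { unfold r1. field. lra. }
  nra.
Qed.

(** * Identity theorem *)

(** The neighbourhoods of the product topology are compared with discs. *)
Lemma Copen_Cmod (U : C -> Prop) :
  Copen U <->
  forall s, U s -> exists r, 0 < r /\ forall t, Cmod (t - s) < r -> U t.
Proof.
split.
- intros H s Hs. specialize (H s Hs).
  apply (locally_norm_le_locally (K := C_AbsRing) (V := C_NormedModule) s _) in H.
  destruct H as [r Hr]. exists r. split; [apply cond_pos|exact Hr].
- intros H s Hs. destruct (H s Hs) as (r & Hr & HU).
  apply (locally_le_locally_norm (K := C_AbsRing) (V := C_NormedModule) s _).
  exists (mkposreal r Hr). exact HU.
Qed.

Lemma Copen_half_plane (sigma : R) : Copen (half_plane sigma).
Proof.
apply Copen_Cmod. unfold half_plane. intros s Hs.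
exists (Re s - sigma). split; [lra|]. intros t Ht.
pose proof (re_le_Cmod (t - s)) as H.
assert (E : Re (t - s)%C = Re t - Re s) by reflexivity.
rewrite E in H. apply Rabs_le_between in H. lra.
Qed.

Lemma analytic_zero_on_connected (h : C -> C) (U H : C -> Prop) :
  Copen U -> Cconnected U -> Copen H -> (exists s, U s /\ H s) ->
  (forall s, U s -> analytic_at h s) ->
  (forall s, U s -> H s -> h s = 0) ->
  forall s, U s -> h s = 0.
Proof.
intros HU Hconn HH [p [Up Hp]] Han Hz s Us.
rewrite Copen_Cmod in HU, HH.
set (V := fun t => exists r, 0 < r /\ forall w, Cmod (w - t) < r -> h w = 0).
set (W := fun t => exists r, 0 < r /\
                     forall w, 0 < Cmod (w - t) < r -> h w <> 0).
(* A point at half the smaller radius would have both properties. *)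
assert (HVW : forall t, V t -> W t -> False).
{ intros t (r & Hr & H1) (r' & Hr' & H2).
  set (m := Rmin r r' / 2).
  assert (Hm : 0 < m) by (unfold m; generalize (Rmin_glb_lt _ _ _ Hr Hr'); lra).
  destruct (Cmod_shift t m ltac:(lra)) as [_ E].
  apply (H2 (t + RtoC m)%C).
  - rewrite E. unfold m in *. generalize (Rmin_r r r'); lra.
  - apply H1. rewrite E. unfold m in *. generalize (Rmin_l r r'); lra. }
assert (Htri : forall a b c : C, Cmod (a - c) <= Cmod (a - b) + Cmod (b - c)).
{ intros a b c. replace (a - c)%C with ((a - b) + (b - c))%C by ring.
  apply Cmod_triangle. }
assert (HV : Copen V).
{ apply Copen_Cmod. intros t (r & Hr & H1). exists (r / 2). split; [lra|].
  intros t' Ht'. exists (r / 2). split; [lra|]. intros w Hw.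
  apply H1. generalize (Htri w t' t). lra. }
(* Around [t' <> t] in the punctured disc, a disc of radius [|t' - t|] avoids
   the possible zero [t]. *)
assert (HW : Copen W).
{ apply Copen_Cmod. intros t (r & Hr & H1). exists (r / 2). split; [lra|].
  intros t' Ht'.
  destruct (Req_dec (Cmod (t' - t)) 0) as [E|E].
  - apply Cmod_eq_0 in E. replace t' with t.
    + now exists r.
    + replace t' with ((t' - t) + t)%C by ring. rewrite E. ring.
  - pose proof (Cmod_ge_0 (t' - t)) as Hpos.
    exists (Cmod (t' - t)). split; [lra|]. intros w [_ Hw]. apply H1.
    generalize (Htri w t' t) (Htri t' w t). intros T1 T2.
    replace (Cmod (t' - w)) with (Cmod (w - t')) in T2.
    + lra.
    + rewrite <- Cmod_opp. f_equal. ring. }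
assert (HUVW : forall t, U t -> V t \/ W t).
{ intros t Ut. exact (isolated_zeros h t (Han t Ut)). }
assert (HVs : V s).
{ destruct (HUVW s Us) as [Hs|Hs]; trivial. exfalso.
  destruct (Hconn V W HV HW HUVW) as (t & _ & H1 & H2); [|now exists s|].
  - exists p. split; trivial.
    destruct (HU p Up) as (r & Hr & H1). destruct (HH p Hp) as (r' & Hr' & H2).
    exists (Rmin r r'). split; [now apply Rmin_glb_lt|]. intros w Hw.
    apply Hz; [apply H1|apply H2];
      (eapply Rlt_le_trans; [exact Hw|]); [apply Rmin_l|apply Rmin_r].
  - exact (HVW t H1 H2). }
destruct HVs as (r & Hr & H1). apply H1.
replace (s - s)%C with (RtoC 0) by ring. now rewrite Cmod_0.
Qed.

Lemma analytic_continuation_unique (f g g' : C -> C) (H U : C -> Prop) :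
  Copen H ->
  analytic_continuation f H g U -> analytic_continuation f H g' U ->
  forall s, U s -> g s = g' s.
Proof.
intros HH (HU & Hconn & Hmeet & Hg & Eg) (_ & _ & _ & Hg' & Eg') s Us.
replace (g s) with (g s - g' s + g' s)%C by ring.
rewrite (analytic_zero_on_connected (fun t => g t - g' t)%C U H); trivial.
- apply Cplus_0_l.
- intros t Ut. apply analytic_at_minus; [now apply Hg|now apply Hg'].
- intros t Ut Ht. rewrite Eg, Eg' by assumption. ring.
Qed.

(** * The Fejér-Dirichlet lift *)

Theorem theorem3p4 :
  forall (a : nat -> C) (sigma0 : R),
    (forall s : C, sigma0 < Re s -> dirichlet_abs_conv a s) ->
    (forall n : nat, (1 <= n)%nat ->
       Cis_series (lift_term a (RtoC (INR n))) (lift a (RtoC (INR n))) /\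
       lift a (RtoC (INR n)) = Csum_list a (divisors n) /\
       Csum_list a (divisors n) = dirichlet_conv a one_fun n) /\
    (let Ta := fun n : nat => lift a (RtoC (INR n)) in
     let H := half_plane (Rmax 1 sigma0) in
     (forall s : C, H s ->
        Cis_series (dirichlet_term Ta s)
          (zeta s * dirichlet_series a s)%C) /\
     (forall (U : C -> Prop) (Z B : C -> C),
        analytic_continuation zeta H Z U ->
        analytic_continuation (dirichlet_series a) H B U ->
        analytic_continuation (dirichlet_series Ta) H
          (fun s => (Z s * B s)%C) U /\
        (forall D : C -> C,
           analytic_continuation (dirichlet_series Ta) H D U ->
           forall s : C, U s -> D s = (Z s * B s)%C))).
Proof.
intros a sigma0 Ha.
assert (Hlift : forall n, (1 <= n)%nat ->
  lift a (RtoC (INR n)) = Csum_list a (divisors n)).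
{ intros n Hn. now apply CSeries_unique, lift_series_at_integer. }
split.
{ intros n Hn. rewrite Hlift by assumption.
  split; [now apply lift_series_at_integer|].
  split; [reflexivity|]. symmetry. apply dirichlet_conv_one. }
intros Ta H.
assert (Hprod : forall s, H s ->
  Cis_series (dirichlet_term Ta s) (zeta s * dirichlet_series a s)%C).
{ intros s Hs. unfold H, half_plane in Hs.
  assert (H1 : 1 < Re s) by (eapply Rle_lt_trans; [apply Rmax_l|exact Hs]).
  assert (H2 : sigma0 < Re s) by (eapply Rle_lt_trans; [apply Rmax_r|exact Hs]).
  generalize (dirichlet_series_divisor_sum a s H1 (Ha s H2)).
  apply is_series_ext. intros k. unfold dirichlet_term, Ta.
  now rewrite Hlift by lia. }
split; [exact Hprod|].
intros U Z B HZ HB.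
assert (HZB : analytic_continuation (dirichlet_series Ta) H
                (fun s => (Z s * B s)%C) U).
{ destruct HZ as (HU & Hconn & Hmeet & HZ & EZ).
  destruct HB as (_ & _ & _ & HB & EB).
  repeat (split; [assumption|]). split.
  - intros s Us. apply analytic_at_mult; [now apply HZ|now apply HB].
  - intros s Us Hs. rewrite EZ, EB by assumption.
    symmetry. now apply CSeries_unique, Hprod. }
split; [exact HZB|].
intros D HD.
exact (analytic_continuation_unique _ _ _ _ _ (Copen_half_plane _) HD HZB).
Qed.
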